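(* Let $L$ be a finite-dimensional solvable Lie algebra over a field $\mathbb{F}$ of arbitrary characteristic. Then $$\dim_{\mathbb{F}} H^1(L,S)=\dim_{\mathbb{F}}\operatorname{End}_L(S)\cdot[L:S]_{\rm split}$$ holds for every finite-dimensional irreducible $L$-module $S$.
   Context: $H^n(L,M)$ denotes the ordinary (Chevalley–Eilenberg) cohomology of a Lie algebra $L$ with coefficients in an $L$-module $M$. A chief series of a finite-dimensional Lie algebra $L$ is an ascending chain $0=L_0\subset L_1\subset\cdots\subset L_n=L$ of ideals of $L$ such that $L_j/L_{j-1}$ is a minimal (non-zero) ideal of $L/L_{j-1}$ for every $1\le j\le n$; each $L_j/L_{j-1}$ is called a chief factor, and it is an $L$-module via the adjoint action. It is called an abelian chief factor if it is an abelian Lie algebra. For a finite-dimensional irreducible $L$-module $S$ and a given chief series of $L$, $[L:S]_{\rm split}$ denotes the number of indices $j$ such that $L_j/L_{j-1}$ is an abelian chief factor isomorphic to $S$ as an $L$-module and the exact sequence $0\to L_j/L_{j-1}\to L/L_{j-1}\to L/L_j\to 0$ splits in the category of Lie algebras. This number does not depend on the choice of the chief series. *)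

(* Defs.v *)
From HB Require Import structures.
From mathcomp Require Import all_boot all_order all_algebra.
From mathcomp Require Import boolp.

Set Implicit Arguments.
Unset Strict Implicit.
Unset Printing Implicit Defensive.

Import GRing.Theory.
Local Open Scope ring_scope.

(** Finite-dimensional Lie algebras; in characteristic 2 it matters that the
    bracket is alternating and not merely antisymmetric. *)

HB.mixin Record isLieAlgebra (F : fieldType) L of Vector F L := {
  lie : L -> L -> L;
  lie_linearl : forall y : L, linear (fun x : L => lie x y);
  lie_linearr : forall x : L, linear (fun y : L => lie x y);
  liexx : forall x : L, lie x x = 0;
  lie_jacobi : forall x y z : L,
    lie x (lie y z) + lie y (lie z x) + lie z (lie x y) = 0
}.

#[short(type="lieAlgType")]
HB.structure Definition LieAlgebra (F : fieldType) :=
  { L of Vector F L & isLieAlgebra F L }.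

HB.mixin Record isLieModule (F : fieldType) (L : lieAlgType F) M
    of Vector F M := {
  act : L -> M -> M;
  act_linearl : forall m : M, linear (fun x : L => act x m);
  act_linearr : forall x : L, linear (fun m : M => act x m);
  act_lie : forall (x y : L) (m : M),
    act (lie x y) m = act x (act y m) - act y (act x m)
}.

#[short(type="lieModType")]
HB.structure Definition LieModule (F : fieldType) (L : lieAlgType F) :=
  { M of Vector F M & isLieModule F L M }.

Section LieBasics.
Variables (F : fieldType) (L : lieAlgType F).
Implicit Types (x y z : L) (U V : {vspace L}).

Lemma lieDl x x' y : lie (x + x') y = lie x y + lie x' y.
Proof. by have := lie_linearl y 1 x x'; rewrite !scale1r. Qed.

Lemma lieDr x y y' : lie x (y + y') = lie x y + lie x y'.
Proof. by have := lie_linearr x 1 y y'; rewrite !scale1r. Qed.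

Lemma lieC x y : lie x y = - lie y x.
Proof.
apply/eqP; rewrite -addr_eq0; apply/eqP.
by have := liexx (x + y); rewrite lieDl !lieDr !liexx add0r addr0.
Qed.

Lemma lieNr x y : lie x (- y) = - lie x y.
Proof.
have lie0 : lie x 0 = 0 by apply: (addrI (lie x 0)); rewrite -lieDr !addr0.
by apply/eqP; rewrite -addr_eq0 -lieDr addNr lie0.
Qed.

Definition is_ideal U : Prop := forall x y, y \in U -> lie x y \in U.

Definition is_abelian U : Prop := {in U &, forall x y, lie x y = 0}.

Definition minimal_ideal U : Prop :=
  [/\ is_ideal U, U <> 0%VS
    & forall V, is_ideal V -> (V <= U)%VS -> V <> 0%VS -> V = U].

(* By bilinearity this is the span of all brackets of elements of U and V. *)
Definition lie_prod U V : {vspace L} :=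
  <<[seq lie x y | x <- vbasis U, y <- vbasis V]>>%VS.

Definition derived_series (k : nat) : {vspace L} :=
  iter k (fun U => lie_prod U U) fullv.

Definition lie_solvable : Prop := exists k, derived_series k = 0%VS.

Record lideal := LIdeal { lideal_vs :> {vspace L}; lidealP : is_ideal lideal_vs }.

End LieBasics.

Arguments lie_solvable {F} L.
Arguments lideal {F} L.

Definition lie_hom (F : fieldType) (L L' : lieAlgType F) (f : 'Hom(L, L')) :=
  forall x y, f (lie x y) = lie (f x) (f y).

(** The quotient L / I is realized on a complement of I, with the projection
    along I as canonical map. *)

Section Quotient.
Variables (F : fieldType) (L : lieAlgType F) (I : lideal L).

Definition quotL : Type := subvs_of (I^C)%VS.
HB.instance Definition _ := Vector.copy quotL (subvs_of (I^C)%VS).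

Definition qpi_fun (x : L) : quotL := vsproj (I^C)%VS (daddv_pi (I^C)%VS I x).

Fact qpi_linear : linear qpi_fun.
Proof. by move=> a x y; rewrite /qpi_fun !linearP. Qed.
HB.instance Definition _ :=
  GRing.isSemilinear.Build F L quotL _ qpi_fun
    (GRing.semilinear_linear qpi_linear).

Definition qpi : 'Hom(L, quotL) := linfun qpi_fun.

Definition qrepr (u : quotL) : L := vsval u.

Fact qrepr_linear : linear qrepr. Proof. exact: linearP. Qed.

Lemma qreprK u : qpi (qrepr u) = u.
Proof.
rewrite lfunE /= /qpi_fun daddv_pi_id ?vsvalK //; last exact: subvsP.
by rewrite capvC capv_compl.
Qed.

Lemma qpi_eq0 x : (qpi x == 0) = (x \in (I : {vspace L})).
Proof.
have capI : ((I^C)%VS :&: I = 0)%VS by rewrite capvC capv_compl.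
have addI : (x \in (I^C)%VS + I)%VS by rewrite addvC addv_complf memvf.
have xE := daddv_pi_add capI addI.
have pE : vsval (qpi x) = daddv_pi (I^C)%VS I x.
  by rewrite lfunE /= vsprojK // memv_pi.
apply/eqP/idP => [p0|xI].
  by rewrite -xE -pE p0 linear0 add0r memv_pi.
apply: val_inj; apply: (etrans pE).
have : daddv_pi (I^C)%VS I x \in ((I^C)%VS :&: I)%VS.
  rewrite memv_cap memv_pi /=.
  have -> : daddv_pi (I^C)%VS I x = x - daddv_pi I (I^C)%VS x.
    by rewrite -{2}xE addrK.
  by rewrite rpredB // memv_pi.
by rewrite capI memv0 => /eqP ->; exact/esym/(linear0 (@vsval _ _ (I^C)%VS)).
Qed.

Lemma qpi_eq x y : (qpi x == qpi y) = (x - y \in (I : {vspace L})).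
Proof. by rewrite -subr_eq0 -linearB qpi_eq0. Qed.

Definition qlie (u v : quotL) : quotL := qpi (lie (qrepr u) (qrepr v)).

Lemma qlieE x y : qlie (qpi x) (qpi y) = qpi (lie x y).
Proof.
apply/eqP; rewrite qpi_eq.
have rI z : qrepr (qpi z) - z \in (I : {vspace L}).
  by rewrite -qpi_eq qreprK.
set x' := qrepr _; set y' := qrepr _.
have -> : lie x' y' - lie x y = lie x' (y' - y) + lie (x' - x) y.
  have -> : lie x' y' = lie x' (y' - y) + lie x' y by rewrite -lieDr subrK.
  have -> : lie x' y = lie (x' - x) y + lie x y by rewrite -lieDl subrK.
  by rewrite addrA addrK.
by rewrite rpredD ?[lie (_ - _) _]lieC ?rpredN ?lidealP ?rI.
Qed.

Fact qlie_linearl v : linear (fun u => qlie u v).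
Proof. by move=> a u u'; rewrite /qlie qrepr_linear lie_linearl linearP. Qed.

Fact qlie_linearr u : linear (fun v => qlie u v).
Proof. by move=> a v v'; rewrite /qlie qrepr_linear lie_linearr linearP. Qed.

Fact qliexx u : qlie u u = 0.
Proof. by rewrite /qlie liexx linear0. Qed.

Fact qlie_jacobi u v w : qlie u (qlie v w) + qlie v (qlie w u) + qlie w (qlie u v) = 0.
Proof.
by rewrite -(qreprK u) -(qreprK v) -(qreprK w) !qlieE -!linearD lie_jacobi linear0.
Qed.

HB.instance Definition _ := isLieAlgebra.Build F quotL
  qlie_linearl qlie_linearr qliexx qlie_jacobi.

Lemma qpi_lie_hom : lie_hom qpi.
Proof. by move=> x y; rewrite -qlieE. Qed.

End Quotient.

Section Factor.
Variables (F : fieldType) (L : lieAlgType F) (I J : lideal L).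

(** J / I as a subspace of L / I (for I contained in J). *)
Definition factor_vs : {vspace quotL I} := (qpi I @: J)%VS.

Lemma factor_ideal : is_ideal factor_vs.
Proof.
move=> u v /memv_imgP [y yJ ->].
by rewrite -(qreprK u) -qpi_lie_hom memv_img ?lidealP.
Qed.

Definition factor : Type := subvs_of factor_vs.
HB.instance Definition _ := Vector.copy factor (subvs_of factor_vs).

Definition factor_act (x : L) (u : factor) : factor :=
  Subvs (factor_ideal (qpi I x) (subvsP u)).

Fact factor_act_linearl u : linear (fun x => factor_act x u).
Proof. by move=> a x y; apply: val_inj; rewrite /= linearP lie_linearl. Qed.

Fact factor_act_linearr x : linear (fun u => factor_act x u).
Proof. by move=> a u v; apply: val_inj; rewrite /= lie_linearr. Qed.

Fact factor_act_lie x y u :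
  factor_act (lie x y) u =
  factor_act x (factor_act y u) - factor_act y (factor_act x u).
Proof.
apply: val_inj; rewrite /= qpi_lie_hom.
have /eqP := lie_jacobi (qpi I x) (qpi I y) (vsval u).
rewrite [lie (vsval u) (qpi I x)]lieC lieNr [lie (vsval u) _]lieC subr_eq0.
by move/eqP <-.
Qed.

HB.instance Definition _ := isLieModule.Build F L factor
  factor_act_linearl factor_act_linearr factor_act_lie.

(** The canonical map L / I -> L / J (for I contained in J). *)
Definition qmap (u : quotL I) : quotL J := qpi J (qrepr u).

Lemma qmapE (sIJ : (I <= J)%VS) x : qmap (qpi I x) = qpi J x.
Proof.
by apply/eqP; rewrite qpi_eq (subvP sIJ) // -qpi_eq qreprK.
Qed.

(** 0 -> J/I -> L/I -> L/J -> 0 splits in the category of Lie algebras. *)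
Definition factor_split : Prop :=
  exists s : 'Hom(quotL J, quotL I), lie_hom s /\ cancel s qmap.

End Factor.

Section Modules.
Variables (F : fieldType) (L : lieAlgType F).

Definition lmod_hom (M N : lieModType L) (f : 'Hom(M, N)) : Prop :=
  forall (x : L) (m : M), f (act x m) = act x (f m).

Definition lmod_iso (M N : lieModType L) : Prop :=
  exists f : 'Hom(M, N), lmod_hom f /\ bijective f.

Definition is_submodule (M : lieModType L) (U : {vspace M}) : Prop :=
  forall (x : L) (m : M), m \in U -> act x m \in U.

Definition lie_irreducible (M : lieModType L) : Prop :=
  (fullv : {vspace M}) <> 0%VS /\
  forall U : {vspace M}, is_submodule U -> U = 0%VS \/ U = fullv.

End Modules.

Section End_L.
Variables (F : fieldType) (L : lieAlgType F) (M : lieModType L).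

Lemma act0l (m : M) : act (0 : L) m = 0.
Proof.
apply: (addrI (act (0 : L) m)); rewrite addr0.
by have := act_linearl m 1 (0 : L) 0; rewrite !scale1r addr0.
Qed.

Definition act_hom (x : L) : 'End(M) := linfun (act x : M -> M).

Lemma act_homE x m : act_hom x m = act x m.
Proof.
pose h := GRing.isSemilinear.Build F M M _ (act x : M -> M)
  (GRing.semilinear_linear (act_linearr x)).
pose g : {linear M -> M} := HB.pack (act x : M -> M) h.
by rewrite /act_hom (lfunE g).
Qed.

Definition lcomm (x : L) (f : 'End(M)) : 'End(M) :=
  (f \o act_hom x)%VF - (act_hom x \o f)%VF.

Fact lcomm_linear x : linear (lcomm x).
Proof.
move=> a f g; rewrite /lcomm comp_lfunDl comp_lfunDr -comp_lfunZl -comp_lfunZr.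
by rewrite scalerBr opprD addrACA.
Qed.
HB.instance Definition _ x :=
  GRing.isSemilinear.Build F 'End(M) 'End(M) _ (lcomm x)
    (GRing.semilinear_linear (lcomm_linear x)).

(** End_L(M): it suffices to commute with the action of a basis of L; see
    [lie_endP]. *)
Definition lie_end : {vspace 'End(M)} :=
  (\bigcap_(i < \dim {:L}) lker (linfun (lcomm (vbasis {:L})`_i)))%VS.

Lemma lie_endP (f : 'End(M)) : f \in lie_end <-> lmod_hom f.
Proof.
have kerP x : f \in lker (linfun (lcomm x)) <->
    forall m, f (act x m) = act x (f m).
  rewrite memv_ker lfunE /= subr_eq0; split.
    by move/eqP/lfunP => h m; have := h m; rewrite !comp_lfunE !act_homE.
  by move=> h; apply/eqP/lfunP => m; rewrite !comp_lfunE !act_homE.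
split=> [fE x m|fE]; last first.
  rewrite /lie_end; elim/big_rec: _ => [|i U _ fU]; first exact: memvf.
  by rewrite memv_cap fU andbT; apply/kerP.
have fB i : f (act (vbasis {:L})`_i m) = act (vbasis {:L})`_i (f m).
  have [lti|gei] := ltnP i (\dim {:L}); last first.
    rewrite nth_default ?size_tuple //.
    by rewrite !act0l linear0.
  have /subvP sK := bigcapv_inf (I := 'I_(\dim {:L})) (Ordinal lti) (P := xpredT)
    (Us := fun i => lker (linfun (lcomm (vbasis {:L})`_i))) isT (subvv _).
  by have /kerP -> := sK _ fE.
rewrite (coord_vbasis (memvf x)).
elim/big_rec: _ => [|i y _ IH]; first by rewrite !act0l linear0.
by rewrite !act_linearl linearP /= fB IH.
Qed.

End End_L.

(** A chief series 0 = c 0, c 1, ..., c n = L; the values c j with j > n are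
    irrelevant. Since c j.+1 / c j is non-zero the inclusions are strict. *)
Definition chief_series (F : fieldType) (L : lieAlgType F)
    (n : nat) (c : nat -> lideal L) : Prop :=
  [/\ c 0 = 0%VS :> {vspace L}, c n = fullv :> {vspace L}
    & forall j, (j < n)%N ->
        (c j <= c j.+1)%VS /\ minimal_ideal (factor_vs (c j) (c j.+1))].

Definition split_factor (F : fieldType) (L : lieAlgType F)
    (S : lieModType L) (I J : lideal L) : Prop :=
  [/\ is_abelian (factor_vs I J), lmod_iso (factor I J) S & factor_split I J].

(** [L : S]_split, computed in the chief series c of length n. *)
Definition split_mult (F : fieldType) (L : lieAlgType F)
    (n : nat) (c : nat -> lideal L) (S : lieModType L) : nat :=
  #|[set j : 'I_n | `[< split_factor S (c j) (c j.+1) >]]|.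

Section Cohomology.
Variables (F : fieldType) (L : lieAlgType F) (M : lieModType L).

Definition setarg n (x : {ffun 'I_n -> L}) (i : 'I_n) (v : L) :
  {ffun 'I_n -> L} := [ffun k => if k == i then v else x k].

(** C^n(L, M): alternating n-linear maps L^n -> M. *)
Definition cochain n (f : {ffun 'I_n -> L} -> M) : Prop :=
  (forall x i, linear (fun v => f (setarg x i v))) /\
  (forall (x : {ffun 'I_n -> L}) (i j : 'I_n), i != j -> x i = x j -> f x = 0).

Definition args n (s : seq L) : {ffun 'I_n -> L} := [ffun k : 'I_n => s`_k].

(** The Chevalley-Eilenberg differential, with arguments indexed from 0:
    df(x_0,..,x_n) = sum_i (-1)^i x_i f(.., omit x_i, ..)
      + sum_(i<j) (-1)^(i+j) f([x_i,x_j], .., omit x_i, .., omit x_j, ..). *)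
Definition CEdiff n (f : {ffun 'I_n -> L} -> M) (x : {ffun 'I_n.+1 -> L}) : M :=
  \sum_(i < n.+1) (-1) ^+ i *:
     act (x i) (f (args n [seq x k | k <- enum 'I_n.+1 & k != i]))
  + \sum_(i < n.+1) \sum_(j < n.+1 | (i < j)%N) (-1) ^+ (i + j)%N *:
     f (args n (lie (x i) (x j) ::
                [seq x k | k <- enum 'I_n.+1 & (k != i) && (k != j)])).

Definition cocycle n (f : {ffun 'I_n -> L} -> M) : Prop :=
  cochain f /\ CEdiff f =1 (fun=> 0).

Definition coboundary n : ({ffun 'I_n -> L} -> M) -> Prop :=
  match n with
  | 0 => fun f => f =1 (fun=> 0)
  | m.+1 => fun f => exists g : {ffun 'I_m -> L} -> M, cochain g /\ f =1 CEdiff g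
  end.

(** dim_F H^n(L, M) = d: there are d cocycles whose classes form a basis of
    cocycles modulo coboundaries. *)
Definition cohomology_dim n (d : nat) : Prop :=
  exists e : 'I_d -> {ffun 'I_n -> L} -> M,
    (forall i, cocycle (e i)) /\
    (forall z, cocycle z ->
       exists! a : 'rV[F]_d, coboundary (fun x => z x - \sum_i a 0 i *: e i x)).

End Cohomology.

Arguments cohomology_dim {F L} M n d.

(* Main.v *)
Require Import Defs.
From HB Require Import structures.
From mathcomp Require Import all_boot all_order all_algebra.
From mathcomp Require Import boolp.

(** In degree 1, cocycles are the derivations [D : L -> S], that is the linear
    maps with [D [x, y] = x (D y) - y (D x)], and coboundaries are the inner
    ones [x |-> x m].  For an ideal [I] let [der S I] be the space of the
    derivations that vanish on [I].  Along a chief series [c] the spaces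
    [der S (c j) + inn S] decrease from all derivations ([c 0 = 0]) to the
    inner ones ([c n = L]), so that the dimension of H^1 is the sum of the
    drops.  The drop at a chief factor [J / I] is [\dim (lie_end S)] if the
    factor contributes to the split multiplicity and 0 otherwise
    ([dim_filtration_step]).  Solvability enters only through the fact that
    [J / I] is abelian ([solvable_chief_abelian]).  There are three cases.

    - [I] acts nontrivially on [S].  A derivation that vanishes on [I] takes
      values in the [I]-invariants of [S], a proper submodule, hence is 0
      ([der0_or_trivial]).
    - [I] acts trivially on [S] and [J] does not.  The elements of [J] then act
      on [S] by commuting operators.  The vectors that are killed by a power of
      a fixed element [a] of [J] form a submodule, so each [a] is nilpotent or
      invertible on [S]; if all were nilpotent, they would have a common
      invariant and [J] would act trivially.  An invertible [a] determines a
      derivation vanishing on [I] by its value at [a], which makes the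
      derivation inner ([der_sub_inn]).

    In these two cases the drop is 0, and [J / I] is not isomorphic to [S],
    because [J] acts trivially on the abelian ideal [J / I]
    ([split_factor_trivial]).

    - [J] acts trivially on [S].  Then inner derivations vanish on [J], and a
      derivation that vanishes on [I] restricts to a module map from [J / I] to
      [S], both irreducible.  A nonzero restriction [D] is an isomorphism, and
      the kernel of [D] is a subalgebra complementing [J] modulo [I], so the
      factor splits ([der_split_factor]); conversely a splitting followed by an
      isomorphism onto [S] is such a [D] ([split_factor_der]).  Once [D]
      exists, the possible restrictions are the maps [f \o D] with [f] in
      End_L(S), all of which extend to [L] ([dim_der_quotient]). *)

Set Implicit Arguments.
Unset Strict Implicit.
Unset Printing Implicit Defensive.

Import GRing.Theory.
Local Open Scope ring_scope.

(** * Subspaces and linear maps given by closed conditions *)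

Section SubspaceOfPredicate.
Variables (F : fieldType) (V : vectType F).

Definition lin_closed (P : V -> Prop) : Prop :=
  P 0 /\ forall a u v, P u -> P v -> P (a *: u + v).

(** Among the subspaces contained in [P], one of maximal dimension contains
    every [v] in [P], since adding the line of [v] stays inside [P]. *)
Lemma ex_vspace (P : V -> Prop) : lin_closed P ->
  exists U : {vspace V}, forall v, v \in U <-> P v.
Proof.
move=> [P0 PD].
pose Q k := `[< exists U : {vspace V}, \dim U = k /\ forall v, v \in U -> P v >].
have exQ : exists k, Q k.
  exists 0%N; apply/asboolP; exists 0%VS; split; first exact: dimv0.
  by move=> v; rewrite memv0 => /eqP ->.
have ubQ k : Q k -> (k <= \dim {:V})%N.
  by move=> /asboolP [U [<- _]]; rewrite dimvS // subvf.
case: (ex_maxnP exQ ubQ) => k /asboolP [U [dU UP]] maxk.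
exists U => v; split=> [|Pv]; first exact: UP.
have /maxk : Q (\dim (<[v]> + U)).
  apply/asboolP; exists (<[v]> + U)%VS; split=> // w.
  by case/memv_addP => _ /vlineP [a ->] [u uU ->]; apply: PD => //; apply: UP.
rewrite -dU => le; have /eqP -> : (U == <[v]> + U)%VS.
  by rewrite eqEdim addvSr.
by rewrite memvE addvSl.
Qed.

Definition vspace_of (P : V -> Prop) (cP : lin_closed P) : {vspace V} :=
  projT1 (cid (ex_vspace cP)).

Lemma mem_vspace_of (P : V -> Prop) (cP : lin_closed P) v :
  v \in vspace_of cP <-> P v.
Proof. exact: (projT2 (cid (ex_vspace cP))). Qed.

Lemma span_pred (P : V -> Prop) (X : seq V) : lin_closed P ->
  (forall v, v \in X -> P v) -> forall v, v \in <<X>>%VS -> P v.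
Proof.
move=> cP XP v vX; apply/(mem_vspace_of cP); apply: subvP vX.
by apply/span_subvP => w /XP /(mem_vspace_of cP).
Qed.

End SubspaceOfPredicate.

Lemma ex_lfun (F : fieldType) (U V : vectType F) (f : U -> V) :
  linear f -> exists g : 'Hom(U, V), forall u, g u = f u.
Proof.
move=> lf.
pose h := GRing.isSemilinear.Build F U V _ f (GRing.semilinear_linear lf).
pose g : {linear U -> V} := HB.pack f h.
by exists (linfun g) => u; rewrite lfunE.
Qed.

(** * Ideals acting on an irreducible module *)

Section ModuleBasics.
Variables (F : fieldType) (L : lieAlgType F) (S : lieModType L).
Implicit Types (x y a : L) (m : S) (I J : {vspace L}).

Lemma actP b x m m' : act x (b *: m + m') = b *: act x m + act x m'.
Proof. exact: act_linearr. Qed.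

Lemma actPl b x y m : act (b *: x + y) m = b *: act x m + act y m.
Proof. exact: (act_linearl m). Qed.

Lemma act0r x : act x (0 : S) = 0.
Proof. by rewrite -act_homE linear0. Qed.

Lemma actNl x m : act (- x) m = - act x m.
Proof. by rewrite -[- x]addr0 -scaleN1r actPl act0l addr0 scaleN1r. Qed.

Lemma actB x m m' : act x (m - m') = act x m - act x m'.
Proof. by rewrite -!act_homE linearB. Qed.

Lemma act_swap x y m : act x (act y m) = act y (act x m) + act (lie x y) m.
Proof. by rewrite act_lie addrC subrK. Qed.

Definition acts_trivially I : Prop := forall y m, y \in I -> act y m = 0.

Hypothesis irrS : lie_irreducible S.

Lemma irreducible_pred (P : S -> Prop) :
    lin_closed P -> (forall x m, P m -> P (act x m)) ->
  (forall m, P m -> m = 0) \/ (forall m, P m).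
Proof.
move=> cP stP; have [] := irrS.2 (vspace_of cP).
- by move=> x m /mem_vspace_of Pm; apply/mem_vspace_of/stP.
- by move=> U0; left=> m /(mem_vspace_of cP); rewrite U0 memv0 => /eqP.
- by move=> UT; right=> m; apply/(mem_vspace_of cP); rewrite UT memvf.
Qed.

(** The invariants of an ideal form a submodule: for [m] invariant,
    [y (x m) = x (y m) + [y, x] m = 0], as [[y, x]] is again in the ideal. *)
Lemma ideal_invariants I : is_ideal I ->
  (forall m, (forall y, y \in I -> act y m = 0) -> m = 0) \/ acts_trivially I.
Proof.
move=> idI.
have [||h|h] := @irreducible_pred (fun m => forall y, y \in I -> act y m = 0).
- split=> [y _|b u v hu hv y yI]; first exact: act0r.
  by rewrite actP hu // hv // scaler0 addr0.
- move=> x m hm y yI.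
  by rewrite act_swap hm // act0r add0r lieC actNl hm ?oppr0 ?idI.
- by left.
- by right=> y m yI; apply: h.
Qed.

Definition act_nil a m := exists k, iter k (act a) m = 0.

(** The vectors killed by a power of [a] form a submodule.  Write
    [a (x m) = x (a m) + [a, x] m]; the first summand is handled by induction on
    the exponent, and the second one because [[a, x]] lies in [J] and therefore
    commutes with [a] on [S].  This holds in every characteristic. *)
Lemma act_nil_dichotomy J a : is_ideal J -> a \in J ->
    (forall y z m, y \in J -> z \in J -> act y (act z m) = act z (act y m)) ->
  (forall m, act a m = 0 -> m = 0) \/ (forall m, act_nil a m).
Proof.
move=> idJ aJ comJ.
have iterP k b u v : iter k (act a) (b *: u + v : S) =
    b *: iter k (act a) u + iter k (act a) v.
  by elim: k => //= k ->; rewrite actP.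
have iter0 k : iter k (act a) (0 : S) = 0 by elim: k => //= k ->; rewrite act0r.
have [||h|h] := @irreducible_pred (act_nil a).
- split=> [|b u v [k hk] [l hl]]; first by exists 0%N.
  exists (k + l)%N; rewrite iterP {1}addnC !iterD hk hl !iter0.
  by rewrite scaler0 addr0.
- move=> x m [k]; elim: k m => [|k IH] m.
    by move=> /= ->; exists 0%N; rewrite /= act0r.
  move=> hm; have [l hl] : act_nil a (act x (act a m)).
    by apply: IH; rewrite -iterSr.
  have [l' hl'] : act_nil a (act (lie a x) m).
    exists k.+1; have axJ : lie a x \in J by rewrite lieC rpredN idJ.
    have -> : iter k.+1 (act a) (act (lie a x) m) =
        act (lie a x) (iter k.+1 (act a) m).
      by elim: (k.+1) => //= i ->; rewrite comJ.
    by rewrite hm act0r.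
  exists (l + l').+1; rewrite iterSr act_swap -[act x _]scale1r iterP scale1r.
  by rewrite {1}addnC !iterD hl hl' !iter0 addr0.
- by left=> m hm; apply: h; exists 1%N.
- by right.
Qed.

(** Commuting nilpotent operators have a common nonzero kernel vector, found
    by treating the elements of a basis of [J] one after the other. *)
Lemma nilpotent_ideal_trivial J : is_ideal J ->
    (forall y z m, y \in J -> z \in J -> act y (act z m) = act z (act y m)) ->
    (forall a m, a \in J -> act_nil a m) ->
  acts_trivially J.
Proof.
move=> idJ comJ nilJ; have [h|//] := ideal_invariants idJ.
have [m [m0 hm]] : exists m, m != 0 /\ forall y, y \in (vbasis J : seq L) -> act y m = 0.
  have : {subset (vbasis J : seq L) <= J} by move=> y /vbasis_mem.
  elim: (vbasis J : seq L) => [_|a s IH sJ].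
    have /eqP := irrS.1; rewrite -subv0 => /subvPn [m _].
    by rewrite memv0 => m0; exists m.
  have [|m [m0 hm]] := IH; first by move=> y ys; apply: sJ; rewrite inE ys orbT.
  have aJ : a \in J by apply: sJ; rewrite inE eqxx.
  have exk : exists k, iter k (act a) m == 0.
    by have [k hk] := nilJ a m aJ; exists k; apply/eqP.
  (* the last nonzero iterate is killed by a, and still by the elements of s *)
  case: (ex_minnP exk) => -[|k] /eqP /= hk mink; first by rewrite hk eqxx in m0.
  exists (iter k (act a) m); split.
    by apply/negP => /mink; rewrite ltnn.
  move=> y; rewrite inE => /predU1P [-> //|ys].
  elim: (k) => [|i IHi] /=; first exact: hm.
  by rewrite comJ ?IHi ?act0r // sJ // inE ys orbT.
case/eqP: m0; apply: h => y yJ.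
apply: (span_pred (P := fun y => act y m = 0) _ hm).
  split=> [|b u v hu hv]; first exact: act0l.
  by rewrite actPl hu hv scaler0 addr0.
by rewrite (span_basis (vbasisP J)).
Qed.

End ModuleBasics.

(** * Derivations with values in a module *)

Section Derivations.
Variables (F : fieldType) (L : lieAlgType F) (S : lieModType L).
Implicit Types (D : 'Hom(L, S)) (x y a : L) (m : S) (I J : {vspace L}).

Definition derivation D : Prop :=
  forall x y, D (lie x y) = act x (D y) - act y (D x).

Definition inner D : Prop := exists m, forall x, D x = act x m.

Fact der_closed I :
  lin_closed (fun D => derivation D /\ forall x, x \in I -> D x = 0).
Proof.
split=> [|b D E [dD zD] [dE zE]].
  by split=> [x y|x _]; rewrite !lfunE /= ?act0r ?subr0.
split=> [x y|x xI]; last first.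
  by rewrite add_lfunE scale_lfunE zD // zE // scaler0 addr0.
rewrite !add_lfunE !scale_lfunE dD dE !actP scalerBr.
by rewrite opprD addrACA.
Qed.

Definition der I : {vspace 'Hom(L, S)} := vspace_of (der_closed I).

Lemma derP I D :
  D \in der I <-> derivation D /\ forall x, x \in I -> D x = 0.
Proof. exact: mem_vspace_of. Qed.

Fact inn_closed : lin_closed inner.
Proof.
split=> [|b D E [m hm] [m' hm']].
  by exists 0 => x; rewrite lfunE act0r.
by exists (b *: m + m') => x; rewrite add_lfunE scale_lfunE hm hm' actP.
Qed.

Definition inn : {vspace 'Hom(L, S)} := vspace_of inn_closed.

Lemma innP D : D \in inn <-> inner D.
Proof. exact: mem_vspace_of. Qed.

Lemma inner_derivation D : inner D -> derivation D.
Proof. by move=> [m hm] x y; rewrite !hm act_lie. Qed.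

Lemma inner_exists m : exists D, forall x, D x = act x m.
Proof. exact: (ex_lfun (act_linearl m)). Qed.

Lemma inn_sub_der I : acts_trivially S I -> (inn <= der I)%VS.
Proof.
move=> tI; apply/subvP => D /innP iD; apply/derP; split.
  exact: inner_derivation.
by case: iD => m hm x xI; rewrite hm tI.
Qed.

Hypothesis irrS : lie_irreducible S.

(** For [y] in [I] the derivation rule at [[x, y]] reads [0 = - y (D x)], so
    the values of [D] are invariants of [I]. *)
Lemma der0_or_trivial I : is_ideal I -> der I = 0%VS \/ acts_trivially S I.
Proof.
move=> idI; have [h|] := ideal_invariants irrS idI; last by right.
left; apply/eqP; rewrite -subv0; apply/subvP => D /derP [dD zD].
rewrite memv0; apply/eqP/lfunP => x; rewrite lfunE /=; apply: h => y yI.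
have := dD x y; rewrite (zD _ (idI _ _ yI)) (zD _ yI) act0r sub0r.
by move/esym/eqP; rewrite oppr_eq0 => /eqP.
Qed.

(** In other words H^1(L / I, S) = 0 if an abelian ideal of [L / I] acts
    nontrivially on [S].  With [a] in [J] acting invertibly,
    choose [m] with [a m = D a]; the inner derivation of [m] agrees with [D] on
    [I] and at [a], and such an agreement propagates to all of [L]. *)
Lemma der_sub_inn I J : is_ideal J ->
    (forall x y, x \in J -> y \in J -> lie x y \in I) ->
    acts_trivially S I -> ~ acts_trivially S J ->
  (der I <= inn)%VS.
Proof.
move=> idJ abJ tI ntJ.
have comJ y z m : y \in J -> z \in J -> act y (act z m) = act z (act y m).
  by move=> yJ zJ; rewrite act_swap (tI _ _ (abJ _ _ yJ zJ)) addr0.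
have [a [aJ inja]] : exists a, a \in J /\ forall m : S, act a m = 0 -> m = 0.
  apply: contrapT => nex; apply: ntJ.
  apply: (nilpotent_ideal_trivial irrS idJ comJ) => a m aJ.
  have [h|//] := act_nil_dichotomy irrS idJ aJ comJ.
  by case: nex; exists a.
have ker0 : lker (act_hom S a) == 0%VS.
  rewrite -subv0; apply/subvP => m; rewrite memv_ker act_homE memv0.
  by move/eqP/inja ->.
apply/subvP => D /derP [dD zD]; apply/innP.
pose m := ((act_hom S a)^-1)%VF (D a).
have am : act a m = D a by rewrite -act_homE lker0_lfunVK.
have [E hE] := inner_exists m.
have dE : derivation E by apply: inner_derivation; exists m.
have eqI x : x \in I -> D x = E x by move=> xI; rewrite zD // hE tI.
(* Agreement at [a, x] gives agreement at x by cancelling a.  It spreads from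
   I to J since [a, J] is contained in I, then to L since [a, L] is in J. *)
have prop x : D (lie a x) = E (lie a x) -> D x = E x.
  rewrite dD dE [E a]hE am => /addIr /eqP; rewrite -subr_eq0 -actB.
  by move/eqP/inja/eqP; rewrite subr_eq0 => /eqP.
exists m => x; rewrite -hE; apply/prop/prop/eqI/abJ => //.
by rewrite lieC rpredN idJ.
Qed.

End Derivations.

(** * Derivations that restrict nontrivially to a chief factor *)

Section Restriction.
Variables (F : fieldType) (L : lieAlgType F) (S : lieModType L).
Hypothesis irrS : lie_irreducible S.
Variables (I J : {vspace L}) (D : 'Hom(L, S)).
Hypotheses (idJ : is_ideal J) (tJ : acts_trivially S J) (sIJ : (I <= J)%VS).
(* [chief_between] derives this from the minimality of J / I. *)
Hypothesis minIJ : forall V : {vspace L}, is_ideal V ->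
  (I <= V)%VS -> (V <= J)%VS -> (V <= I)%VS \/ (J <= V)%VS.
Hypotheses (DI : D \in der S I) (nDJ : D \notin der S J).

Let derD : derivation D. Proof. by case/derP: DI. Qed.

Lemma der_lie_ideal x y : y \in J -> D (lie x y) = act x (D y).
Proof. by move=> yJ; rewrite derD (tJ _ yJ) subr0. Qed.

Lemma der_nonzero_on : exists2 y, y \in J & D y != 0.
Proof.
apply: contrapT => nex; case/negP: nDJ; apply/derP; split=> // x xJ.
by apply/eqP; apply: contra_notT nex => Dx; exists x.
Qed.

(** [J :&: lker D] is an ideal between [I] and [J] and is not [J]. *)
Lemma der_kernel y : y \in J -> D y = 0 -> y \in I.
Proof.
have kJ x : x \in (J :&: lker D)%VS <-> x \in J /\ D x = 0.
  rewrite memv_cap memv_ker; split=> [/andP [-> /eqP] //|[-> ->]].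
  by rewrite eqxx.
have [||||h] := minIJ (V := (J :&: lker D)%VS).
- move=> x z /kJ [zJ Dz]; apply/kJ; split; first exact: idJ.
  by rewrite der_lie_ideal // Dz act0r.
- apply/subvP => x xI; apply/kJ; split; first exact: (subvP sIJ).
  by case/derP: DI => _; apply.
- exact: capvSl.
- by move=> /subvP h yJ Dy; apply: h; apply/kJ.
- have [z zJ /negP []] := der_nonzero_on.
  by have /kJ [_ ->] := subvP h _ zJ.
Qed.

Lemma der_image : (D @: J)%VS = fullv.
Proof.
have [||//] := irrS.2 (D @: J)%VS.
  move=> x _ /memv_imgP [y yJ ->].
  by rewrite -der_lie_ideal // memv_img // idJ.
have [y yJ Dy] := der_nonzero_on => h.
by case/negP: Dy; rewrite -memv0 -h memv_img.
Qed.

(** [g] inverts the isomorphism of [J / I] onto [S] induced by [D], up to a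
    choice of representatives in [J]. *)
Lemma der_section :
  exists g : 'Hom(S, L), forall m, g m \in J /\ D (g m) = m.
Proof.
pose h := (D \o projv J)%VF.
exists (projv J \o h^-1)%VF => m; rewrite comp_lfunE; split.
  exact: memv_proj.
have mh : m \in limg h.
  have : m \in (D @: J)%VS by rewrite der_image memvf.
  case/memv_imgP => y yJ ->; apply/memv_imgP; exists y; first exact: memvf.
  by rewrite comp_lfunE projv_id.
by have := limg_lfunVK mh; rewrite comp_lfunE.
Qed.

(** Composition with the section [g] of [D] measures the restriction to [J] of
    a derivation [E] in [der S I]: the kernel of [E |-> E \o g] is [der S J],
    and its image is End_L(S), because [f] is the image of [f \o D]. *)
Lemma dim_der_quotient : \dim (der S I) = (\dim (der S J) + \dim (lie_end S))%N.
Proof.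
have [g gP] := der_section.
pose r_fun (E : 'Hom(L, S)) : 'End(S) := (E \o g)%VF.
have r_lin : linear r_fun.
  by move=> b E E'; rewrite /r_fun comp_lfunDl -comp_lfunZl.
(* r is E |-> E \o g as a linear map, to which rank-nullity applies *)
have [r rfE] := ex_lfun r_lin.
have rE E m : r E m = E (g m) by rewrite rfE comp_lfunE.
rewrite -(limg_ker_dim r (der S I)); congr (_ + _)%N; congr dimv.
  apply/vspaceP => E; rewrite memv_cap memv_ker.
  apply/andP/idP => [[/derP [dE zE] /eqP rE0]|/derP [dE zE]].
    apply/derP; split=> // y yJ.
    have /zE : y - g (D y) \in I.
      have [gJ Dg] := gP (D y).
      by apply: der_kernel; rewrite ?rpredB // linearB /= Dg subrr.
    by rewrite linearB /= -rE rE0 lfunE subr0.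
  split; first by apply/derP; split=> // x xI; apply: zE; apply: (subvP sIJ).
  by apply/eqP/lfunP => m; rewrite rE lfunE /=; apply: zE; case: (gP m).
apply/vspaceP => f; apply/memv_imgP/idP => [[E /derP [dE zE] ->]|/lie_endP fE].
  apply/lie_endP => x m; rewrite !rE.
  have [gJ Dg] := gP m; have [gxJ Dgx] := gP (act x m).
  have /zE : g (act x m) - lie x (g m) \in I.
    apply: der_kernel; first by rewrite rpredB // idJ.
    by rewrite linearB /= der_lie_ideal // Dg Dgx subrr.
  move/eqP; rewrite linearB /= subr_eq0 => /eqP ->.
  by rewrite dE (tJ _ gJ) subr0.
exists (f \o D)%VF; last first.
  by apply/lfunP => m; rewrite rE comp_lfunE; case: (gP m) => _ ->.
apply/derP; split=> [x y|x xI]; rewrite !comp_lfunE.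
  by rewrite derD linearB /= !fE.
by case/derP: DI => _ ->; rewrite ?linear0.
Qed.

End Restriction.

(** * Chief factors *)

Section ChiefFactor.
Variables (F : fieldType) (L : lieAlgType F) (I J : lideal L).
Hypothesis sIJ : (I <= J)%VS.
Implicit Types (x y : L) (U V : {vspace L}).

Lemma mem_factor_vs x :
  (qpi I x \in factor_vs I J) = (x \in (J : {vspace L})).
Proof.
apply/idP/idP => [/memv_imgP [y yJ /eqP]|]; last exact: memv_img.
by rewrite qpi_eq => /(subvP sIJ) h; rewrite -(subrK y x) rpredD.
Qed.

Lemma factor_abelianP :
  is_abelian (factor_vs I J) <->
  forall x y, x \in (J : {vspace L}) -> y \in (J : {vspace L}) ->
    lie x y \in (I : {vspace L}).
Proof.
split=> [ab x y xJ yJ|ab _ _ /memv_imgP [x xJ ->] /memv_imgP [y yJ ->]].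
  by rewrite -qpi_eq0 qpi_lie_hom ab ?mem_factor_vs.
by rewrite -qpi_lie_hom; apply/eqP; rewrite qpi_eq0 ab.
Qed.

Hypothesis minIJ : minimal_ideal (factor_vs I J).

Lemma chief_not_sub : ~ (J <= I)%VS.
Proof.
move/subvP => sJI; case: minIJ => _ + _; apply.
apply/eqP; rewrite -subv0; apply/subvP => _ /memv_imgP [x /sJI xI ->].
by rewrite memv0 qpi_eq0.
Qed.

(** Minimality of [J / I] in [L / I], pulled back to [L]. *)
Lemma chief_between V : is_ideal V -> (I <= V)%VS -> (V <= J)%VS ->
  (V <= I)%VS \/ (J <= V)%VS.
Proof.
move=> idV sIV sVJ; case: minIJ => _ _ /(_ (qpi I @: V)%VS).
move=> /(_ (@factor_ideal _ _ I (LIdeal idV))) /(_ (limgS _ sVJ)) h.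
have [W0|/eqP/h WJ] := eqVneq (qpi I @: V)%VS 0%VS; [left|right].
  by apply/subvP => v vV; rewrite -qpi_eq0 -memv0 -W0 memv_img.
apply/subvP => x; rewrite -mem_factor_vs -WJ => /memv_imgP [v vV /eqP].
by rewrite qpi_eq => /(subvP sIV) h'; rewrite -(subrK v x) rpredD.
Qed.

End ChiefFactor.

(** * Chief factors of solvable algebras are abelian *)

Section Solvable.
Variables (F : fieldType) (L : lieAlgType F).
Implicit Types (x y : L) (U V W : {vspace L}).

Lemma lie0r x : lie x 0 = 0.
Proof. by rewrite -[X in lie x X](subrr x) lieDr lieNr subrr. Qed.

(** Used with [x'] and [y'] in an abelian ideal, to compare the bracket of [x]
    and [y] with that of their projections to a complement. *)
Lemma lie_sub_shift x y x' y' : lie x' y' = 0 ->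
  lie x y - lie (x - x') (y - y') = lie x y' - lie y x'.
Proof.
move=> xy0; rewrite lieDl !lieDr !lieNr [lie (- x') y]lieC [lie (- x') y']lieC.
rewrite !lieNr [lie y' x']lieC xy0 !oppr0 addr0 opprK.
by rewrite -addrA opprD addrA subrr add0r opprD opprK.
Qed.

Lemma lie_prod_mem U V x y : x \in U -> y \in V -> lie x y \in lie_prod U V.
Proof.
rewrite -{1}(span_basis (vbasisP U)) -{1}(span_basis (vbasisP V)) => xU yV.
apply: (span_pred (P := fun x => lie x y \in lie_prod U V) _ _ xU) => [|{xU}x xU].
  split=> [|b u v hu hv]; first by rewrite lieC lie0r oppr0 mem0v.
  by rewrite lie_linearl memvD // memvZ.
apply: (span_pred (P := fun y => lie x y \in lie_prod U V) _ _ yV) => [|{yV}y yV].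
  split=> [|b u v hu hv]; first by rewrite lie0r mem0v.
  by rewrite lie_linearr memvD // memvZ.
by apply/memv_span/allpairsP; exists (x, y).
Qed.

Lemma lie_prod_ideal U V : is_ideal U -> is_ideal V -> is_ideal (lie_prod U V).
Proof.
move=> idU idV z w wUV.
apply: (span_pred (P := fun w => lie z w \in lie_prod U V) _ _ wUV).
  split=> [|b u v hu hv]; first by rewrite lie0r mem0v.
  by rewrite lie_linearr memvD // memvZ.
move=> _ /allpairsP [[x y] /= [/vbasis_mem xU /vbasis_mem yV ->]].
have -> : lie z (lie x y) = lie x (lie z y) + lie (lie z x) y.
  rewrite [lie z y]lieC lieNr [lie (lie z x) y]lieC -opprD.
  by apply/eqP; rewrite -addr_eq0 addrA lie_jacobi.
by rewrite memvD // lie_prod_mem ?idU ?idV.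
Qed.

Lemma derived_series_ideal k : is_ideal (derived_series L k).
Proof.
by elim: k => [x y _|k IH]; [exact: memvf | exact: lie_prod_ideal].
Qed.

(** Let [k] be the last index with [J] contained in [derived_series L k + I].
    The ideal [(derived_series L k.+1 + I) :&: J] lies between [I] and [J] and
    is not [J], hence is [I]; it contains all brackets of elements of [J]. *)
Lemma solvable_chief_abelian (I J : lideal L) : lie_solvable L ->
    (I <= J)%VS -> minimal_ideal (factor_vs I J) ->
  is_abelian (factor_vs I J).
Proof.
move=> [K K0] sIJ minIJ; apply/factor_abelianP => // x y xJ yJ.
pose Q k := ~~ (J <= derived_series L k + I)%VS.
have exQ : exists k, Q k.
  by exists K; rewrite /Q K0 add0v; apply/negP/chief_not_sub.
case: (ex_minnP exQ) => -[|k] Qk mink.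
  by case/negP: Qk; apply: subv_trans (subvf J) (addvSl _ _).
have sJ : (J <= derived_series L k + I)%VS.
  by apply: contraT => /mink; rewrite ltnn.
pose V := ((derived_series L k.+1 + I) :&: J)%VS.
have idDI : is_ideal (derived_series L k.+1 + I)%VS.
  move=> z _ /memv_addP [u uD [v vI ->]].
  by rewrite lieDr memv_add ?derived_series_ideal ?lidealP.
have [|||/subvP sVI|sJV] := chief_between sIJ minIJ (V := V).
- move=> z w /=; rewrite !memv_cap => /andP [wD wJ].
  by rewrite idDI // lidealP.
- by rewrite subv_cap addvSr.
- exact: capvSr.
- apply: sVI; rewrite memv_cap lidealP // andbT.
  have /memv_addP [u uD [v vI ->]] := subvP sJ _ xJ.
  have /memv_addP [u' u'D [v' v'I ->]] := subvP sJ _ yJ.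
  rewrite lieDl lieDr -addrA memv_add ?lie_prod_mem //.
  apply: rpredD; first exact: lidealP.
  by rewrite lieC rpredN lidealP.
- by case/negP: Qk; apply: subv_trans sJV (capvSl _ _).
Qed.

End Solvable.

(** * Split factors and derivations *)

Section Splitting.
Variables (F : fieldType) (L : lieAlgType F) (S : lieModType L).
Variables (I J : lideal L).
Hypothesis sIJ : (I <= J)%VS.
Implicit Types (x y : L).

Lemma split_factor_trivial : split_factor S I J -> acts_trivially S J.
Proof.
move=> [ab [phi [hphi [psi _ psiK]]] _] y m yJ; rewrite -(psiK m) -hphi.
have -> : act y (psi m) = 0; last by rewrite linear0.
apply: val_inj; apply: (ab _ _ _ (subvsP _)).
by rewrite mem_factor_vs.
Qed.

(** A splitting [s] gives the projection [x |-> x - s x] of [L / I] onto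
    [J / I]; followed by the isomorphism onto [S] it is the derivation [D].  The
    defect of the derivation rule is a bracket of two elements of [J / I], which
    is 0. *)
Lemma split_factor_der : minimal_ideal (factor_vs I J) -> split_factor S I J ->
  exists2 D, D \in der S I & D \notin der S J.
Proof.
move=> minIJ [ab [phi [hphi /bij_inj iphi]] [s [hs sK]]].
pose v x := qpi I x - s (qpi J x).
have vF x : v x \in factor_vs I J.
  rewrite -(qreprK (v x)) mem_factor_vs // -qpi_eq0.
  have -> : qpi J (qrepr (v x)) = qpi J x - qmap J (s (qpi J x)).
    rewrite -(qmapE sIJ) qreprK /v /qmap.
    by rewrite /qrepr !linearB /= -/(qrepr _) -/(qmap J _) (qmapE sIJ).
  by rewrite sK subrr.
pose w x : factor I J := Subvs (vF x).
have w_lin : linear (fun x => phi (w x)).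
  move=> b x y; rewrite -linearP; congr (phi _); apply: val_inj.
  by rewrite /= /v !linearP /= scalerDr addrACA.
have [D DE] := ex_lfun w_lin.
have w0 x : v x = 0 -> D x = 0.
  move=> vx0; rewrite DE; have -> : w x = 0 by apply: val_inj.
  exact: linear0.
have derD : derivation D.
  move=> x y; rewrite !DE -!hphi -linearB; congr (phi _); apply: val_inj => /=.
  have e z : s (qpi J z) = qpi I z - v z by rewrite /v opprB addrC subrK.
  by rewrite {1}/v !qpi_lie_hom hs !e lie_sub_shift // ab.
exists D.
  apply/derP; split=> // x xI; apply: w0; rewrite /v.
  have /eqP -> : qpi I x == 0 by rewrite qpi_eq0.
  have /eqP -> : qpi J x == 0 by rewrite qpi_eq0 (subvP sIJ).
  by rewrite linear0 subr0.
apply/negP => /derP [_ DJ0]; apply: (chief_not_sub minIJ).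
apply/subvP => x xJ; rewrite -qpi_eq0; apply/eqP.
have /eqP qJx : qpi J x == 0 by rewrite qpi_eq0.
have : w x = 0 by apply: iphi; rewrite linear0 -DE DJ0.
by move/(congr1 val); rewrite /= /v qJx linear0 subr0.
Qed.

(** [D] induces the isomorphism of [J / I] with [S], and its kernel is the
    subalgebra that splits the extension. *)
Lemma der_split_factor (D : 'Hom(L, S)) : lie_irreducible S ->
    minimal_ideal (factor_vs I J) -> is_abelian (factor_vs I J) ->
    acts_trivially S J -> D \in der S I -> D \notin der S J ->
  split_factor S I J.
Proof.
move=> irrS minIJ ab tJ DI nDJ; have [derD DI0] := (derP _ _).1 DI.
have idJ := @lidealP _ _ J; have btw := chief_between sIJ minIJ.
have DJ := der_lie_ideal tJ DI.
have kerD := der_kernel idJ tJ sIJ btw DI nDJ.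
have [g gP] := der_section irrS idJ tJ DI nDJ.
have DeqI x y : qpi I x = qpi I y -> D x = D y.
  move/eqP; rewrite qpi_eq => /DI0 /eqP.
  by rewrite linearB /= subr_eq0 => /eqP.
have reprJ (t : factor I J) : qrepr (vsval t) \in (J : {vspace L}).
  by rewrite -(mem_factor_vs sIJ) // qreprK subvsP.
split=> //.
  have phi_lin : linear (fun t : factor I J => D (qrepr (vsval t))).
    by move=> b t u; rewrite /qrepr !linearP.
  have [phi phiE] := ex_lfun phi_lin.
  have hphi : lmod_hom phi.
    move=> x t; rewrite !phiE -DJ //; apply: DeqI.
    by rewrite qreprK qpi_lie_hom qreprK.
  exists phi; split=> //.
  pose psi m : factor I J := Subvs (memv_img (qpi I) (gP m).1).
  have phiK m : phi (psi m) = m.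
    by rewrite phiE /= -[RHS](gP m).2; apply: DeqI; rewrite qreprK.
  exists psi => // t; apply/eqP; rewrite -subr_eq0; apply/eqP.
  set u := _ - _; have : phi u = 0 by rewrite linearB /= phiK subrr.
  rewrite phiE => /(kerD _ (reprJ u)); rewrite -qpi_eq0 qreprK => /eqP u0.
  exact: val_inj.
(* k projects L onto the kernel of D along representatives of J / I *)
pose k x := x - g (D x).
have Dk x : D (k x) = 0 by rewrite linearB /= (gP _).2 subrr.
have qk x : qpi J (k x) = qpi J x.
  by apply/eqP; rewrite qpi_eq /k addrC addKr rpredN (gP _).1.
have s_lin : linear (fun u : quotL J => qpi I (k (qrepr u))).
  move=> b u v; rewrite /k -linearP /=; congr (qpi I _).
  by rewrite /qrepr !linearP /= scalerDr addrACA.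
have [s sE] := ex_lfun s_lin.
exists s; split=> [u v|u]; last by rewrite sE qmapE // qk qreprK.
rewrite !sE -qpi_lie_hom; apply/eqP; rewrite qpi_eq; apply: kerD.
  rewrite -qpi_eq qk qreprK qpi_lie_hom !qk !qreprK.
  exact: eqxx.
by rewrite linearB /= derD !Dk !act0r !subr0.
Qed.

End Splitting.

(** * Dimensions along a chief series *)

Section Filtration.
Variables (F : fieldType) (L : lieAlgType F) (S : lieModType L).
Hypotheses (solL : lie_solvable L) (irrS : lie_irreducible S).

Lemma dim_filtration_step (I J : lideal L) :
    (I <= J)%VS -> minimal_ideal (factor_vs I J) ->
  \dim (der S I + inn S) =
    (\dim (der S J + inn S) + \dim (lie_end S) * `[< split_factor S I J >])%N.
Proof.
move=> sIJ minIJ; have ab := solvable_chief_abelian solL sIJ minIJ.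
have sder : (der S J <= der S I)%VS.
  apply/subvP => D /derP [dD DJ]; apply/derP; split=> // x xI.
  by apply: DJ; apply: (subvP sIJ).
have [tJ|ntJ] := pselect (acts_trivially S J); last first.
  have sinn : (der S I <= inn S)%VS.
    have [->|tI] := der0_or_trivial irrS (@lidealP _ _ I); first exact: sub0v.
    apply: (der_sub_inn irrS (@lidealP _ _ J)) tI ntJ.
    exact/factor_abelianP.
  have -> : `[< split_factor S I J >] = false.
    by apply/asboolP => /(split_factor_trivial sIJ).
  rewrite muln0 addn0 (addv_idPr _) // (addv_idPr _) //.
  exact: subv_trans sder sinn.
have tI : acts_trivially S I by move=> y m /(subvP sIJ); apply: tJ.
rewrite !(addv_idPl _) ?inn_sub_der //.
have [[D DI nDJ]|nD] := pselect (exists2 D, D \in der S I & D \notin der S J).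
  have -> : `[< split_factor S I J >] = true.
    exact/asboolP/(der_split_factor sIJ irrS minIJ ab tJ DI nDJ).
  rewrite muln1; apply: dim_der_quotient DI nDJ => //; first exact: lidealP.
  exact: chief_between.
have -> : `[< split_factor S I J >] = false.
  by apply/asboolP => /(split_factor_der sIJ minIJ).
rewrite muln0 addn0; congr dimv; apply/eqP; rewrite eqEsubv sder andbT.
by apply/subvP => D DI; apply: contraT => nDJ; case: nD; exists D.
Qed.

Lemma dim_der_chief_series n c : chief_series n c ->
  \dim (der S 0) = (\dim (inn S) + \dim (lie_end S) * split_mult n c S)%N.
Proof.
move=> [c0 cn step].
have der_full : der S fullv = 0%VS.
  apply/eqP; rewrite -subv0; apply/subvP => D /derP [_ D0].
  by rewrite memv0; apply/eqP/lfunP => x; rewrite lfunE /= D0 ?memvf.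
have sinn : (inn S <= der S 0)%VS.
  by apply: inn_sub_der => y m; rewrite memv0 => /eqP ->; apply: act0l.
pose b j := `[< split_factor S (c j) (c j.+1) >].
have -> : split_mult n c S = (\sum_(j < n) b j)%N.
  rewrite /split_mult cardsE -sum1_card big_mkcond /=.
  by apply: eq_bigr => j _; rewrite unfold_in -/(b j); case: (b j).
have : forall k, (k <= n)%N -> \dim (der S (c 0) + inn S) =
    (\dim (der S (c k) + inn S) + \dim (lie_end S) * \sum_(j < k) b j)%N.
  elim=> [|k IH] lt_kn; first by rewrite big_ord0 muln0 addn0.
  have [sub min] := step k lt_kn.
  rewrite IH 1?ltnW // (dim_filtration_step sub min) big_ord_recr /= mulnDr.
  by rewrite addnAC -addnA.
move/(_ n (leqnn n)); rewrite c0 cn der_full add0v => <-.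
by congr dimv; apply/esym/addv_idPl.
Qed.

End Filtration.

(** * Degree 1 cohomology as derivations modulo inner ones *)

Section FirstCohomology.
Variables (F : fieldType) (L : lieAlgType F) (M : lieModType L).
Implicit Types (f z : {ffun 'I_1 -> L} -> M) (D : 'Hom(L, M)).

Definition arg1 (x : L) : {ffun 'I_1 -> L} := [ffun=> x].

Lemma arg1_eta (x : {ffun 'I_1 -> L}) : arg1 (x ord0) = x.
Proof. by apply/ffunP => i; rewrite ffunE (ord1 i). Qed.

(** Up to the passage from one-entry families to vectors, the vanishing of this
    expression is the derivation rule. *)
Lemma CEdiff1 f (x : {ffun 'I_2 -> L}) :
  CEdiff f x = act (x ord0) (f (arg1 (x ord_max)))
    - act (x ord_max) (f (arg1 (x ord0))) - f (arg1 (lie (x ord0) (x ord_max))).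
Proof.
have args1 y s : args 1 (y :: s) = arg1 y.
  by apply/ffunP => i; rewrite !ffunE (ord1 i).
have max2 : lift ord0 ord0 = ord_max :> 'I_2 by apply: val_inj.
rewrite /CEdiff !big_ord_recl !big_ord0 /= !big_mkcond !big_ord_recl !big_ord0 /=.
rewrite !enum_ordSl /= !enum_ord0 /= !max2 /= !args1.
rewrite expr0 expr1 !scale1r !scaleN1r !addr0 !add0r.
by rewrite [X in _ + (_ + X)]big1 ?addr0 // => j; case: j => -[|[|]].
Qed.

Definition eval1 D (x : {ffun 'I_1 -> L}) : M := D (x ord0).

Lemma cocycle_eval1 D : derivation D -> cocycle (eval1 D).
Proof.
move=> derD; split; last first.
  by move=> x; rewrite CEdiff1 /eval1 !ffunE derD subrr.
split=> [x i b u v|x i j]; last by rewrite !ord1.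
by rewrite /eval1 !ffunE (ord1 i) eqxx linearP.
Qed.

Lemma cocycleP z : cocycle z ->
  exists2 D, derivation D & z =1 eval1 D.
Proof.
move=> [[linz _] dz].
have arg1_set (x : L) : setarg (arg1 0) ord0 x = arg1 x.
  by apply/ffunP => i; rewrite !ffunE (ord1 i).
have [|D DE] := @ex_lfun _ _ _ (fun x => z (arg1 x)).
  by move=> b u v; have := linz (arg1 0) ord0 b u v; rewrite !arg1_set.
exists D => [x y|x]; last by rewrite /eval1 DE arg1_eta.
have /eqP := dz [ffun i : 'I_2 => if i == ord0 then x else y].
by rewrite CEdiff1 !ffunE /= subr_eq0 !DE => /eqP.
Qed.

Lemma coboundaryP z D : z =1 eval1 D ->
  coboundary z <-> inner D.
Proof.
move=> zE; pose e0 : {ffun 'I_0 -> L} := [ffun=> 0].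
have e0E x : x = e0 by apply/ffunP => -[].
have d0 (g : {ffun 'I_0 -> L} -> M) x : CEdiff g x = act (x ord0) (g e0).
  rewrite /CEdiff !big_ord_recl !big_ord0 /= big_mkcond big_ord_recl big_ord0 /=.
  by rewrite expr0 scale1r !addr0 (e0E (args _ _)).
split=> [[g [_ gE]]|[m hm]].
  exists (g e0) => x; have := gE (arg1 x).
  by rewrite zE d0 /eval1 ffunE.
exists (fun=> m); split; last by move=> x; rewrite zE d0 /eval1 hm.
by split=> [x []|x []].
Qed.

(** A basis of a complement of the inner derivations represents a basis of the
    quotient. *)
Lemma cohomology_dim1 d :
  (\dim (der M 0) = \dim (inn M) + d)%N -> cohomology_dim M 1 d.
Proof.
move=> dimE.
have sinn : (inn M <= der M 0)%VS.
  by apply: inn_sub_der => y m; rewrite memv0 => /eqP ->; apply: act0l.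
pose U := (der M 0 :\: inn M)%VS.
have dU : \dim U = d.
  have := dimv_cap_compl (der M 0) (inn M).
  by rewrite (capv_idPr sinn) dimE => /addnI.
have derU D : D \in U -> derivation D.
  by move/(subvP (diffvSl _ _))/derP => [].
subst d; pose e (i : 'I_(\dim U)) := eval1 (vbasis U)`_i.
have eE (D : 'Hom(L, M)) (a : 'rV_(\dim U)) :
    (fun x => eval1 D x - \sum_i a 0 i *: e i x) =1
    eval1 (D - \sum_i a 0 i *: (vbasis U)`_i).
  move=> x; rewrite /eval1 add_lfunE opp_lfunE sum_lfunE; congr (_ - _).
  by apply: eq_bigr => i _; rewrite scale_lfunE.
exists e; split=> [i|z /cocycleP [D derD zE]].
  by apply/cocycle_eval1/derU/vbasis_mem/mem_nth; rewrite size_tuple.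
have cobE (a : 'rV[F]_(\dim U)) : coboundary (fun x => z x - \sum_i a 0 i *: e i x) <->
    D - \sum_i a 0 i *: (vbasis U)`_i \in inn M.
  rewrite innP; apply: coboundaryP => x; rewrite zE; exact: eE.
have DU : D \in (U + inn M)%VS.
  rewrite addv_diff; apply: (subvP (addvSl _ _)); apply/derP; split=> // x.
  by rewrite memv0 => /eqP ->; apply: linear0.
have [u uU [v vI Duv]] := memv_addP DU.
exists (\row_i coord (vbasis U) i u); split.
  apply/cobE; under eq_bigr do rewrite mxE.
  by rewrite -(coord_vbasis uU) Duv addrC addKr.
move=> a /cobE aI; apply/rowP => i; rewrite mxE.
set w := \sum_i _ in aI.
have wU : w \in U.
  by apply: memv_suml => j _; rewrite memvZ // vbasis_mem // mem_nth ?size_tuple.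
have : u - w \in (U :&: inn M)%VS.
  rewrite memv_cap rpredB //=.
  have -> : u - w = (D - w) - v by rewrite Duv addrAC addrK.
  by rewrite rpredB.
rewrite capv_diff memv0 subr_eq0 => /eqP ->.
by rewrite coord_sum_free // (basis_free (vbasisP U)).
Qed.

End FirstCohomology.

Theorem theorem2p3 (F : fieldType) (L : lieAlgType F) (S : lieModType L)
  (n : nat) (c : nat -> lideal L) :
  lie_solvable L -> lie_irreducible S -> chief_series n c ->
  cohomology_dim S 1 (\dim (lie_end S) * split_mult n c S)%N.
Proof.
move=> solL irrS cS; apply: cohomology_dim1.
exact: dim_der_chief_series.
Qed.
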